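(* Let $N\ge 1$, $n\ge 1$, and let $\mathcal{L}=a^N(x)\frac{d^N}{dx^N}+\dots+a^1(x)\frac{d}{dx}+a^0(x)$ be a linear differential operator on $[-1,1]$ with smooth coefficients $a^0,\dots,a^N$ and $a^N(x)\ne 0$. Let $\phi_0,\dots,\phi_{n-1}$ be trial functions given by $(\phi_0|\cdots|\phi_{n-1})=(T_0|T_1|\cdots|T_{n+N-1})R$ and $\psi_0,\dots,\psi_{n-1}$ test functions given by $(\psi_0|\cdots|\psi_{n-1})=(C^{(N)}_0|C^{(N)}_1|\cdots|C^{(N)}_{n+N-1})Q$, where $R$ and $Q$ are the $(n+N)\times n$ stencil matrices described in the context. Let $\omega(x)=(1-x^2)^{N-1/2}$ and let $A$ be the $n\times n$ Petrov--Galerkin coefficient matrix with entries $A(i,j)=(\psi_i,\mathcal{L}\phi_j)_\omega$, $0\le i,j\le n-1$. Then $$A=Q^{T}\,\Omega_{n+N-1}\,L_{n+N-1}\,R,$$ where $$\Omega_{n+N-1}=\operatorname{diag}(d_0,\dots,d_{n+N-1}),\qquad d_j=\frac{\pi\,2^{1-2N}\,\Gamma(j+2N)}{j!\,(j+N)\,[\Gamma(N)]^2},$$ and $$L_{n+N-1}=\mathcal{P}_{n+N-1}\Big(\mathcal{M}_N[a^N]\mathcal{D}_N+\sum_{k=0}^{N-1}\mathcal{S}_{N-1}\cdots\mathcal{S}_k\,\mathcal{M}_k[a^k]\,\mathcal{D}_k\Big)\mathcal{P}_{n+N-1}^{\top},$$ with $\mathcal{P}_{n+N-1}=(I_{n+N},0)$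 the projection onto the first $n+N$ components (indices $0,\dots,n+N-1$).
   Context: $T_j$ is the Chebyshev polynomial of the first kind and $C^{(k)}_j$ the ultraspherical (Gegenbauer) polynomial of parameter $k\ge1$, normalized by $C^{(k)}_0=1$, $C^{(k)}_1=2kx$, $(j+1)C^{(k)}_{j+1}=2(j+k)xC^{(k)}_j-(j+2k-1)C^{(k)}_{j-1}$. $(f,g)_\omega=\int_{-1}^1 f g\,\omega\,dx$. All rows, columns and indices start at $0$. $(f_0|f_1|\cdots)M$ denotes the list of functions whose $j$th member is $\sum_i f_i M_{ij}$. Stencil matrices. $\mathcal{B}_0,\dots,\mathcal{B}_{N-1}$ are $N$ linear functionals (homogeneous boundary conditions or side constraints). Column $k$ of $R$ is supported in rows $k,\dots,k+N$, with entries $\gamma^k_0,\dots,\gamma^k_N$, $\gamma^k_N\ne0$, chosen so that $\phi_k=\sum_{j=0}^N\gamma^k_jT_{k+j}$ satisfies $\mathcal{B}_i\phi_k=0$ for all $i$. $Q$ has the same shape and sparsity: $\psi_k$ is a linear combination of $C^{(N)}_k,\dots,C^{(N)}_{k+N}$ chosen to satisfy prescribed homogeneous linear constraints (the same ones, or dual boundary conditions). Operators (infinite matrices): - $\mathcal{D}_0=\mathcal{I}$ is the identity; for $k\ge1$, $\mathcal{D}_k$ has entries $(\mathcal{D}_k)_{j,j+k}=2^{k-1}(k-1)!\,(j+k)$, $j\ge0$, and zeros elsewhere. It maps the $T$-coefficients of a function to the $C^{(k)}$-coefficients of its $k$th derivative. - $\mathcal{S}_0$ has entries $(\mathcal{S}_0)_{00}=1$,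 $(\mathcal{S}_0)_{jj}=\frac12$ for $j\ge1$, $(\mathcal{S}_0)_{j,j+2}=-\frac12$, zeros elsewhere; it maps $T$-coefficients to $C^{(1)}$-coefficients. For $k\ge1$, $(\mathcal{S}_k)_{jj}=\frac{k}{k+j}$, $(\mathcal{S}_k)_{j,j+2}=-\frac{k}{k+j+2}$, zeros elsewhere; it maps $C^{(k)}$-coefficients to $C^{(k+1)}$-coefficients. - $\mathcal{M}_k[a]$ is the multiplication operator: column $j$ of $\mathcal{M}_0[a]$ contains the Chebyshev coefficients of $a(x)T_j(x)$, and for $k\ge1$ column $j$ of $\mathcal{M}_k[a]$ contains the $C^{(k)}$-coefficients of $a(x)C^{(k)}_j(x)$. Equivalently, for $a=\sum_j a_jC^{(k)}_j$ one has $\mathcal{M}_k[a]=\sum_j a_j\mathcal{M}_k[C^{(k)}_j]$, where $\mathcal{M}_k[C^{(k)}_0]=\mathcal{I}$, $\mathcal{M}_k[C_1^{(k)}]=2k\mathcal{M}_k[x]$, $\mathcal{M}_k[C^{(k)}_{j+1}]=\frac{2(j+k)}{j+1}\mathcal{M}_k[x]\mathcal{M}_k[C^{(k)}_j]-\frac{j+2k-1}{j+1}\mathcal{M}_k[C^{(k)}_{j-1}]$ for $j\ge1$, and $\mathcal{M}_k[x]$ is tridiagonal with zero diagonal, superdiagonal entries $(\mathcal{M}_k[x])_{j,j+1}=\frac{2k+j}{2(k+j+1)}$ and subdiagonal entries $(\mathcal{M}_k[x])_{j+1,j}=\frac{j+1}{2(k+j)}$. Smooth means infinitely differentiable on $[-1,1]$,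 so that all Chebyshev and ultraspherical expansions of the coefficients converge. *)

(* Defs.v *)
From HB Require Import structures.
From mathcomp Require Import all_boot all_order all_algebra.
From mathcomp Require Import all_classical all_reals all_analysis.

Set Implicit Arguments.
Unset Strict Implicit.
Unset Printing Implicit Defensive.

Import Order.TTheory GRing.Theory Num.Theory.
Import numFieldNormedType.Exports.

Local Open Scope classical_set_scope.
Local Open Scope ring_scope.

Fixpoint chebyshev_poly (R : realType) (j : nat) : {poly R} :=
  match j with
  | 0 => 1
  | 1 => 'X
  | (i.+1 as i1).+1 => 2 *: ('X * chebyshev_poly R i1) - chebyshev_poly R i
  end.

(* The three-term recurrence, read at index i.+1 and solved for C_{i+2}. *)
Fixpoint gegenbauer_poly (R : realType) (k j : nat) : {poly R} :=
  match j with
  | 0 => 1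
  | 1 => (2 * k)%:R *: 'X
  | (i.+1 as i1).+1 =>
      (2 * (i1 + k)%:R / i1.+1%:R) *: ('X * gegenbauer_poly R k i1)
      - ((i1 + 2 * k).-1%:R / i1.+1%:R) *: gegenbauer_poly R k i
  end.

(* The basis indexed by k: T_j for k = 0 and C^(k)_j for k >= 1. *)
Definition ubasis (R : realType) (k j : nat) : {poly R} :=
  if k == 0%N then chebyshev_poly R j else gegenbauer_poly R k j.

Definition uweight (R : realType) (k : nat) (x : R) : R :=
  (1 - x ^+ 2) `^ (k%:R - 2^-1).

(* For k = 0 the weight is singular (but integrable) at -1 and 1, hence the
   Lebesgue integral. *)
Definition uinner (R : realType) (k : nat) (f g : R -> R) : R :=
  \int[lebesgue_measure]_(x in `[(-1 : R), 1]) (f x * g x * uweight k x).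

(* The i-th Chebyshev (k = 0) or C^(k) (k >= 1) coefficient of f in its
   expansion in the orthogonal family [ubasis R k]. *)
Definition ucoef (R : realType) (k : nat) (f : R -> R) (i : nat) : R :=
  uinner k f (horner (ubasis R k i)) /
  uinner k (horner (ubasis R k i)) (horner (ubasis R k i)).

(* The members of the list (f_0|f_1|...|f_(m-1)) M. *)
Definition quasimul (R : realType) (f : nat -> {poly R}) (m n : nat)
    (M : 'M[R]_(m, n)) (j : 'I_n) : {poly R} :=
  \sum_(i < m) M i j *: f i.

(* Infinite matrices; the series in a product is finitely supported whenever
   a left factor is row-finite or a right factor is column-finite. *)
Definition infmx (R : realType) := nat -> nat -> R.

Definition infmx1 (R : realType) : infmx R := fun i j => (i == j)%:R.

Definition infmx_mul (R : realType) (A B : infmx R) : infmx R :=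
  fun i j => limn (series (fun l => A i l * B l j)).

(* P_m X P_m^T with P_m = (I_m, 0). *)
Definition infmx_section (R : realType) (m : nat) (X : infmx R) : 'M[R]_m :=
  \matrix_(i < m, j < m) X i j.

Definition diffop (R : realType) (k : nat) : infmx R :=
  if k == 0%N then infmx1 R
  else fun i j =>
    if j == (i + k)%N then 2 ^+ k.-1 * (k.-1)`!%:R * (i + k)%:R else 0.

Definition convop (R : realType) (k : nat) : infmx R :=
  if k == 0%N then
    fun i j =>
      if j == i then (if i == 0%N then 1 else 2^-1)
      else if j == i.+2 then - 2^-1 else 0
  else
    fun i j =>
      if j == i then k%:R / (k + i)%:R
      else if j == i.+2 then - (k%:R / (k + i + 2)%:R) else 0.

(* S_(N-1) ... S_(k+1) S_k, highest index leftmost. *)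
Definition convop_prod (R : realType) (N k : nat) : infmx R :=
  \big[@infmx_mul R/infmx1 R]_(l <- rev (index_iota k N)) convop R l.

Definition multop (R : realType) (k : nat) (a : R -> R) : infmx R :=
  fun i j => ucoef k (fun x => a x * (ubasis R k j).[x]) i.

Definition us_operator (R : realType) (N : nat) (a : nat -> R -> R) :
    infmx R :=
  fun i j =>
    infmx_mul (multop N (a N)) (diffop R N) i j
    + \sum_(k < N)
        infmx_mul (convop_prod R N k)
                  (infmx_mul (multop k (a k)) (diffop R k)) i j.

Definition diff_operator (R : realType) (N : nat) (a : nat -> R -> R)
    (u : R -> R) : R -> R :=
  fun x => \sum_(k < N.+1) a k x * derive1n k u x.

(* g is the sequence of successive derivatives of f relative to D, so that
   they are one-sided at the endpoints when D is an interval. *)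
Definition smooth_on (R : realType) (D : set R) (f : R -> R) : Prop :=
  exists g : nat -> R -> R,
    (forall x, D x -> g 0%N x = f x) /\
    (forall (k : nat) (x : R), D x ->
       (fun y => (g k y - g k x) / (y - x)) @ within D x^' --> g k.+1 x).

Definition stencil_banded (R : realType) (N n : nat)
    (M : 'M[R]_(n + N, n)) : Prop :=
  forall (i : 'I_(n + N)) (k : 'I_n), ~~ (k <= i <= k + N)%N -> M i k = 0.

Definition Gamma (R : realType) (z : R) : R :=
  \int[lebesgue_measure]_(t in `]0, +oo[) (t `^ (z - 1) * expR (- t)).

Definition dnorm (R : realType) (N j : nat) : R :=
  pi * (2 : R) ^ (1 - (2 * N)%:Z) * Gamma (j + 2 * N)%:R
  / (j`!%:R * (j + N)%:R * Gamma N%:R ^+ 2).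

(* Main.v *)
(** On [-1, 1] every weight is a polynomial multiple of the Chebyshev weight
    w_0, so polynomial inner products reduce to one functional I, determined by
    I(1) = pi and by integration by parts, I((1 - x^2) p' - x p) = 0. The norms
    of T_j and C^(k)_j follow from it and the three-term recurrences.

    No convergence of expansions is needed: the identity
    (1 - x^2) C^(k+1)_i = alpha_i C^(k)_i + beta_i C^(k)_{i+2}, integrated against
    f w_k, says that S_k maps the C^(k)-coefficients of f to its
    C^(k+1)-coefficients, as S_k has only two nonzero entries per row.
    Hence the (l, m) entry of the operator matrix is the l-th C^(N)-coefficient
    of L T_m, i.e. (C^(N)_l, L T_m) / d_l, and bilinearity gives the theorem. *)

Require Import Defs.
From HB Require Import structures.
From mathcomp Require Import all_boot all_order all_algebra.
From mathcomp Require Import all_classical all_reals all_analysis.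
From mathcomp Require Import measurable_realfun ring lra.

Import Order.TTheory GRing.Theory Num.Theory.
Import numFieldNormedType.Exports.

Local Open Scope classical_set_scope.
Local Open Scope ring_scope.

Lemma fact_eq0 (k : nat) : (k`! == 0)%N = false.
Proof. by rewrite eqn0Ngt fact_gt0. Qed.

Local Ltac field_neq0 :=
  rewrite ?(nat1r, natr1, =^~ natrD, =^~ natrM, =^~ natrX) ?pnatr_eq0
    ?(addnS, expn_eq0, fact_eq0).

(** * Chebyshev and Gegenbauer polynomials *)

Section ultraspherical_polynomials.
Set Implicit Arguments.
Unset Strict Implicit.
Context {R : realType}.
Implicit Types (p q : {poly R}) (x : R) (j k i : nat).

Local Notation T := (chebyshev_poly R).
Local Notation C := (gegenbauer_poly R).

Lemma derive1n_horner k p : derive1n k (horner p) = horner p^`(k).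
Proof. by elim: k => [//|k ih]; rewrite derive1nS ih derivnS derivE. Qed.

(** The i-th coefficient times i! is the i-th derivative at 0, which depends only on the polynomial
    function. Polynomial identities can thus be checked pointwise with [ring] and [field]. *)
Lemma polyfunP p q : (forall x, p.[x] = q.[x]) -> p = q.
Proof.
move=> pq; apply/polyP => i; apply: (@mulIf _ (i`!%:R : R)).
  by rewrite pnatr_eq0 -lt0n fact_gt0.
suff E : forall r : {poly R}, r`_i * i`!%:R = derive1n i (horner r) 0.
  by rewrite !E (_ : horner p = horner q)//; apply/funext.
by move=> r; rewrite derive1n_horner horner_coef0 coef_derivn addn0 ffactnn mulr_natr.
Qed.

Lemma natrS_neq0 j i : j%:R + i.+1%:R != 0 :> R.
Proof. by rewrite -natrD pnatr_eq0 addnS. Qed.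

Lemma chebyshev0E x : (T 0).[x] = 1. Proof. exact: hornerC. Qed.

Lemma chebyshev1E x : (T 1).[x] = x. Proof. exact: hornerX. Qed.

Lemma chebyshev_rec j x :
  (T j.+2).[x] = 2 * x * (T j.+1).[x] - (T j).[x].
Proof. by rewrite [T j.+2]/= !hornerE. Qed.

Lemma gegenbauer0E k x : (C k 0).[x] = 1. Proof. exact: hornerC. Qed.

Lemma gegenbauer1E k x : (C k 1).[x] = 2 * k%:R * x.
Proof. by rewrite /= !hornerE natrM. Qed.

Lemma gegenbauer_rec k j x :
  (j%:R + 2) * (C k j.+2).[x] =
  2 * (j%:R + k%:R + 1) * x * (C k j.+1).[x] - (j%:R + 2 * k%:R) * (C k j).[x].
Proof.
have j2 := natrS_neq0 j 1.
have -> : C k j.+2 = (2 * (j.+1 + k)%:R / j.+2%:R) *: ('X * C k j.+1)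
  - ((j + 2 * k)%:R / j.+2%:R) *: C k j by [].
rewrite hornerD hornerN !hornerZ hornerM hornerX (natrD _ j.+1 k)
  (natrD _ j (2 * k)) natrM -(natr1 j.+1) -(natr1 j).
by field.
Qed.

Lemma gegenbauer1_rec j x :
  (C 1 j.+2).[x] = 2 * x * (C 1 j.+1).[x] - (C 1 j).[x].
Proof.
by apply: (mulfI (natrS_neq0 j 1)); rewrite gegenbauer_rec; ring.
Qed.

(** The first identity at j with the recurrence for C^(1) gives the second at j.+1, so the two are
    proved by one induction. *)
Lemma chebyshev_gegenbauer1 j x :
  (T j.+2).[x] = x * (C 1 j.+1).[x] - (C 1 j).[x] /\
  (T j.+1).[x] = (C 1 j.+1).[x] - x * (C 1 j).[x].
Proof.
elim: j => [|j [ih1 ih2]].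
  rewrite chebyshev_rec chebyshev1E chebyshev0E gegenbauer1E.
  by split; ring.
have z2 := gegenbauer1_rec j x.
have e : (T j.+2).[x] = (C 1 j.+2).[x] - x * (C 1 j.+1).[x].
  by rewrite ih1 z2; ring.
by split => //; rewrite chebyshev_rec ih2 e z2; ring.
Qed.

(** The two identities feed each other: the first at j and the recurrence for C^(k+1) give the
    second at j.+1; the recurrence for C^(k) then gives the first at j.+1. *)
Lemma gegenbauerS k j x :
  (j%:R + 2) * (C k j.+2).[x] =
    2 * k%:R * (x * (C k.+1 j.+1).[x] - (C k.+1 j).[x]) /\
  (j%:R + 1 + 2 * k%:R) * (C k j.+1).[x] =
    2 * k%:R * ((C k.+1 j.+1).[x] - x * (C k.+1 j).[x]).
Proof.
elim: j => [|j [ih1 ih2]].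
  rewrite gegenbauer_rec !gegenbauer1E !gegenbauer0E.
  by split; ring.
have j2 := natrS_neq0 j 1.
have rz := gegenbauer_rec k.+1 j x.
have ry := gegenbauer_rec k j.+1 x.
rewrite -!(natr1 k) -!(natr1 j) in rz ry *.
set y3 := (C k j.+3).[x] in ry *; set y2 := (C k j.+2).[x] in ry ih1 *.
set y1 := (C k j.+1).[x] in ry ih2.
set z2 := (C k.+1 j.+2).[x] in rz *; set z1 := (C k.+1 j.+1).[x] in rz ih1 ih2 *.
set z0 := (C k.+1 j).[x] in rz ih1 ih2 *.
have e : (j%:R + 1 + 1 + 2 * k%:R) * y2 = 2 * k%:R * (z2 - x * z1).
  apply: (mulfI j2).
  have -> : (j%:R + 2) * ((j%:R + 1 + 1 + 2 * k%:R) * y2) =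
    (j%:R + 1 + 1 + 2 * k%:R) * ((j%:R + 2) * y2) by ring.
  have -> : (j%:R + 2) * (2 * k%:R * (z2 - x * z1)) =
    2 * k%:R * ((j%:R + 2) * z2 - (j%:R + 2) * (x * z1)) by ring.
  by rewrite ih1 rz; ring.
split=> //.
(* The coefficient 2 (j + k + 2) of x y2 is split as (j + 2) + (j + 2 + 2 k), the factors on the
   left of [ih1] and [e]. *)
have -> : (j%:R + 1 + 2) * y3 = x * ((j%:R + 2) * y2 +
  (j%:R + 1 + 1 + 2 * k%:R) * y2) - (j%:R + 1 + 2 * k%:R) * y1.
  by rewrite ry; ring.
by rewrite ih1 e ih2; ring.
Qed.

Lemma subX2_chebyshev j x :
  (1 - x ^+ 2) * (C 1 j).[x] = 2^-1 * ((T j).[x] - (T j.+2).[x]).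
Proof.
case: j => [|j].
  by rewrite chebyshev_rec chebyshev1E chebyshev0E; field.
have [e1 _] := chebyshev_gegenbauer1 j.+1 x.
have [_ e2] := chebyshev_gegenbauer1 j x.
by rewrite e1 e2 gegenbauer1_rec; field.
Qed.

(** For positive index, [gegenbauerS] turns both terms on the right into C^(k+1) terms, and the
    recurrence removes the highest of them. Index 0 is separate because the second identity of
    [gegenbauerS] starts at C^(k)_1. *)
Lemma subX2_gegenbauer k j x :
  4 * k%:R * (j%:R + k%:R + 1) * ((1 - x ^+ 2) * (C k.+1 j).[x]) =
  (j%:R + 2 * k%:R) * (j%:R + 2 * k%:R + 1) * (C k j).[x]
  - (j%:R + 1) * (j%:R + 2) * (C k j.+2).[x].
Proof.
case: j => [|j].
  have := gegenbauer_rec k 0 x.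
  rewrite !gegenbauer1E !gegenbauer0E => e.
  have -> : (0 + 1) * (0 + 2) * (C k 2).[x] = (0 + 2) * (C k 2).[x] by ring.
  by rewrite e; ring.
have [e1 _] := gegenbauerS k j.+1 x.
have [_ e2] := gegenbauerS k j x.
have rz := gegenbauer_rec k.+1 j x.
rewrite -!(natr1 k) -!(natr1 j) in rz e1 *.
have -> : (j%:R + 1 + 2 * k%:R) * (j%:R + 1 + 2 * k%:R + 1) * (C k j.+1).[x] =
  (j%:R + 1 + 2 * k%:R + 1) * ((j%:R + 1 + 2 * k%:R) * (C k j.+1).[x]) by ring.
have -> : (j%:R + 1 + 1) * (j%:R + 1 + 2) * (C k j.+3).[x] =
  (j%:R + 1 + 1) * ((j%:R + 1 + 2) * (C k j.+3).[x]) by ring.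
rewrite e1 e2.
have -> : forall a b c d : R, (j%:R + 1 + 1) * (2 * k%:R * (x * a - b)) =
  2 * k%:R * (x * ((j%:R + 2) * a) - (j%:R + 2) * b) by move=> *; ring.
all: try exact: 0.
by rewrite rz; ring.
Qed.

Lemma deriv_chebyshev j : (T j.+1)^`() = (j.+1)%:R *: C 1 j.
Proof.
apply/polyfunP => x; rewrite hornerZ.
(* The recurrence reaches back two indices, so two consecutive instances are carried through the
   induction. *)
pose P j := (T j)^`().[x] = j%:R * (C 1 j.-1).[x].
suff : P j.+1 by [].
suff : P j.+1 /\ P j.+2 by case.
rewrite /P; elim: j => [|j [ih1 ih2]].
  rewrite /= derivB derivZ derivM derivX derivC.
  by rewrite ?(hornerD, hornerN, hornerZ, hornerM, hornerX, hornerC); split; ring.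
split=> //.
rewrite [T j.+3]/= linearB linearZ /= derivM derivX hornerD hornerN hornerZ.
rewrite hornerD !hornerM hornerX hornerC.
rewrite -/(T j.+2) ih2 ih1.
have [e1 e2] := chebyshev_gegenbauer1 j x.
have z2 := gegenbauer1_rec j x.
rewrite e1 z2 /=; ring.
Qed.

(** Two-step induction on the differentiated recurrence [dC]; the undifferentiated terms it produces
    are rewritten by [gegenbauerS]. *)
Lemma deriv_gegenbauer k j :
  (C k j.+1)^`() = (2 * k)%:R *: C k.+1 j.
Proof.
apply/polyfunP => x; rewrite hornerZ.
pose P i := (C k i.+1)^`().[x] = (2 * k)%:R * (C k.+1 i).[x].
suff : P j by [].
suff : P j /\ P j.+1 by case.
have dC i : (i%:R + 2) * (C k i.+2)^`().[x] =
    2 * (i%:R + k%:R + 1) * ((C k i.+1).[x] + x * (C k i.+1)^`().[x])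
    - (i%:R + 2 * k%:R) * (C k i)^`().[x].
  have E : (i%:R + 2)%:P * C k i.+2 =
      (2 * (i%:R + k%:R + 1))%:P * 'X * C k i.+1 - (i%:R + 2 * k%:R)%:P * C k i.
    apply/polyfunP => y; have := gegenbauer_rec k i y.
    move: (C k i.+2) (C k i.+1) (C k i) => p q r.
    by rewrite hornerD hornerN !hornerM !hornerC hornerX.
  move: (C k i.+2) (C k i.+1) (C k i) E => p q r E.
  have := congr1 (fun p => (deriv p).[x]) E.
  rewrite derivB !derivM derivX !derivC ?(hornerD, hornerN, hornerM, hornerX, hornerC) => e.
  by apply: etrans; [|apply: (etrans e)]; ring.
rewrite /P; elim: j => [|j [ih1 ih2]].
  have dC1 : (C k 1)^`().[x] = (2 * k)%:R by rewrite /= derivZ derivX hornerZ hornerC mulr1.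
  have dC0 : (C k 0)^`().[x] = 0 by rewrite /= derivC hornerC.
  split; first by rewrite dC1 gegenbauer0E; ring.
  apply: (mulfI (natrS_neq0 0 1)).
  by rewrite dC dC1 dC0 !gegenbauer1E; ring.
split=> //.
have [e1 _] := gegenbauerS k j x; have [_ e2] := gegenbauerS k j.+1 x.
apply: (mulfI (natrS_neq0 j.+1 1)).
rewrite dC ih1 ih2.
have rz := gegenbauer_rec k.+1 j x.
move: (C k j.+2).[x] (C k.+1 j.+2).[x] (C k.+1 j.+1).[x] (C k.+1 j).[x]
  e1 e2 rz => y2 z2 z1 z0 e1 e2 rz.
have -> : 2 * (j.+1%:R + k%:R + 1) * (y2 + x * ((2 * k)%:R * z1)) =
  (j%:R + 2) * y2 + (j.+1%:R + 1 + 2 * k%:R) * y2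
  + 2 * (j.+1%:R + k%:R + 1) * x * ((2 * k)%:R * z1) by ring.
have -> : (j.+1%:R + 2) * ((2 * k)%:R * z2) =
  (2 * k)%:R * ((j%:R + 2) * z2 + z2) by ring.
by rewrite e1 e2 rz; ring.
Qed.

(** The scalar is the only nonzero entry of column j of [diffop R k.+1], in row j - k.+1; for j <= k
    that column and the derivative both vanish. *)
Lemma derivn_chebyshev k j : (T j)^`(k.+1) =
  if (k < j)%N then (2 ^+ k * k`!%:R * j%:R) *: C k.+1 (j - k.+1) else 0.
Proof.
elim: k => [|k ih].
  rewrite derivn1; case: j => [|j]; first by rewrite /= derivC.
  by rewrite deriv_chebyshev subn1 expr0 fact0 !mul1r.
rewrite derivnS ih; case: (ltnP k j) => [kj|jk]; last first.
  by rewrite deriv0 ltnNge (leq_trans jk).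
rewrite derivZ; case: (ltnP k.+1 j) => [kj1|jk1].
  have -> : (j - k.+1)%N = (j - k.+2).+1 by rewrite -subSn.
  rewrite deriv_gegenbauer scalerA; congr (_ *: _).
  by rewrite factS exprS !natrM; ring.
have -> : (j - k.+1)%N = 0%N by apply/eqP; rewrite subn_eq0.
by rewrite /= derivC scaler0.
Qed.

End ultraspherical_polynomials.

(** * Orthogonality from a three-term recurrence *)

Section orthogonal_sequence.
Set Implicit Arguments.
Unset Strict Implicit.
Context {R : realType}.
Variables (F : {poly R} -> R) (P : nat -> {poly R}) (A B : nat -> R).
Hypothesis F_linear : forall a b p q, F (a *: p + b *: q) = a * F p + b * F q.
Hypothesis A_neq0 : forall j, A j != 0.
(** At j = 0 the truncated predecessor makes [P j.-1] equal to [P 0]; this removes the spurious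
    term. *)
Hypothesis B0 : B 0%N = 0.
Hypothesis recP : forall j, 'X * P j = A j *: P j.+1 + B j *: P j.-1.
Hypothesis FP : forall j, F (P 0%N * P j.+1) = 0.

(** Multiplication by X is symmetric for the form F (p q). Expanding it on either side lowers the
    first index from i.+1 to i and below, which drives the induction for orthogonality. *)
Let mulX i j : A i * F (P i.+1 * P j) =
  A j * F (P i * P j.+1) + B j * F (P i * P j.-1) - B i * F (P i.-1 * P j).
Proof.
have E : F ('X * P i * P j) = F (P i * ('X * P j)) by congr (F _); ring.
rewrite !recP mulrDl mulrDr -!scalerAl -!scalerAr !F_linear in E.
by rewrite -E; ring.
Qed.

Lemma orthogonal_sequence i j : (i < j)%N -> F (P i * P j) = 0.
Proof.
elim/ltn_ind: i j => -[|i] ih [//|j] ij; first exact: FP.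
have ij' : (i < j)%N by [].
apply: (mulfI (A_neq0 i)); rewrite mulX mulr0.
rewrite (ih i (ltnSn i) j.+2 (ltnW (ltnW ij))) (ih i (ltnSn i) j ij').
rewrite !mulr0 !add0r.
case: i ih ij ij' => [|i] ih ij ij'; first by rewrite B0 mul0r oppr0.
by rewrite (ih i _ j.+1) ?mulr0 ?oppr0//; do 2 apply: ltnW.
Qed.

(** In [mulX] at (j, j.+1) the two terms whose indices differ by 2 vanish by orthogonality. *)
Lemma orthogonal_sequence_norm j :
  A j * F (P j.+1 * P j.+1) = B j.+1 * F (P j * P j).
Proof.
rewrite mulX orthogonal_sequence// mulr0 add0r.
case: j => [|j]; first by rewrite B0 mul0r subr0.
by rewrite (orthogonal_sequence (i := j))// mulr0 subr0.
Qed.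

End orthogonal_sequence.

(** * Norms *)

Section gegenbauer_moments.
Set Implicit Arguments.
Unset Strict Implicit.
Context (R : realType).
Implicit Types (p q : {poly R}) (x : R) (j k i : nat).

Local Notation T := (chebyshev_poly R).
Local Notation C := (gegenbauer_poly R).

(** For k >= 1 this is [dnorm] with Gamma values written as factorials and 2^(1-2k) as 2 / 4^k (see
    [dnormE]). It is the square of the norm of C^(k)_j. *)
Definition gegenbauer_norm k j : R :=
  pi * 2 / 4 ^+ k * ((j + 2 * k).-1)`!%:R
  / (j`!%:R * (j + k)%:R * ((k.-1)`!%:R) ^+ 2).

Definition ubasis_norm k j : R :=
  if k is 0 then if j is 0 then pi else pi / 2 else gegenbauer_norm k j.

Lemma ubasis_norm_neq0 k j : ubasis_norm k j != 0.
Proof.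
have pi0 := pi_gt0 R.
case: k => [|k]; first by case: j => [|j]; rewrite lt0r_neq0// divr_gt0.
rewrite lt0r_neq0// /ubasis_norm /gegenbauer_norm.
rewrite divr_gt0 ?mulr_gt0 ?exprz_gt0 ?exprn_gt0 ?ltr0n ?fact_gt0//.
by rewrite addnS.
Qed.

(** The ratio in k serves the induction in [weighted1] and the coefficients in [subX2_ubasis]; the
    ratio in j, next, serves the induction on the degree. *)
Lemma gegenbauer_norm_shift k j :
  4 * k.+1%:R ^+ 2 * (j%:R + k.+1%:R + 1) * gegenbauer_norm k.+2 j =
  (j%:R + 2 * k.+1%:R) * (j%:R + 2 * k.+1%:R + 1) * (j%:R + k.+1%:R) *
    gegenbauer_norm k.+1 j.
Proof.
rewrite /gegenbauer_norm.
have -> : (j + 2 * k.+2).-1 = (j + 2 * k.+1).-1.+2 by rewrite !mulnS !addnS.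
have -> : (j + 2 * k.+1)%N = (j + 2 * k).+2 by rewrite !mulnS !addnS.
rewrite -[k.+2.-1]/k.+1 (factS k) -[(j + 2 * k).+2.-1]/(j + 2 * k).+1.
rewrite !(factS (j + 2 * k).+2) !(factS (j + 2 * k).+1) !natrM !exprS; field.
by field_neq0.
Qed.

Lemma gegenbauer_normS k j : j.+1%:R * (j%:R + 1 + k.+1%:R) * gegenbauer_norm k.+1 j.+1 =
  (j%:R + 2 * k.+1%:R) * (j%:R + k.+1%:R) * gegenbauer_norm k.+1 j.
Proof.
rewrite /gegenbauer_norm !addSn succnK.
have -> : (j + 2 * k.+1)%N = (j + 2 * k).+2 by rewrite mulnS addnA addn2.
rewrite !factS !exprS !succnK; field.
by field_neq0.
Qed.

(** Stands for integration against w_0; [uinner_ubasis_norm] supplies the actual integral. *)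
Variable I : {poly R} -> R.
Hypothesis I_linear : forall a b p q, I (a *: p + b *: q) = a * I p + b * I q.
Hypothesis I1 : I 1 = pi.
Hypothesis I_parts : forall p, I ((1 - 'X^2) * p^`() - 'X * p) = 0.

Let IZ a p : I (a *: p) = a * I p.
Proof. by have := I_linear a 0 p 0; rewrite scaler0 addr0 mul0r addr0. Qed.

(** Since w_k = (1 - x^2)^k w_0, this plays the role of integration against w_k. *)
Let weighted k p := I ((1 - 'X^2) ^+ k * p).

(** The minus sign is kept inside the scalar so that [I_linear] applies directly. *)
Lemma subX2_chebyshev_poly j :
  (1 - 'X^2) * C 1 j = 2^-1 *: T j + (- 2^-1) *: T j.+2.
Proof.
apply/polyfunP => x.
rewrite hornerD !hornerZ hornerM hornerD hornerN hornerXn hornerC.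
by rewrite subX2_chebyshev; ring.
Qed.

Lemma subX2_gegenbauer_poly k j : (1 - 'X^2) * C k.+2 j =
  ((j%:R + 2 * k.+1%:R) * (j%:R + 2 * k.+1%:R + 1) /
    (4 * k.+1%:R * (j%:R + k.+1%:R + 1))) *: C k.+1 j
  + (- ((j%:R + 1) * (j%:R + 2) /
    (4 * k.+1%:R * (j%:R + k.+1%:R + 1)))) *: C k.+1 j.+2.
Proof.
have c0 : 4 * k.+1%:R * (j%:R + k.+1%:R + 1) != 0 :> R.
  by rewrite !mulf_neq0 ?pnatr_eq0// -natrD natr1 pnatr_eq0.
apply/polyfunP => x.
rewrite hornerD !hornerZ hornerM hornerD hornerN hornerXn hornerC.
apply: (mulfI c0); rewrite subX2_gegenbauer; field.
by field_neq0.
Qed.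

(** Integration by parts is applied to p = C^(1)_j, for which (1 - x^2) p' - x p is a nonzero
    multiple of T_(j+1). *)
Lemma chebyshev_moment j : I (T j.+1) = 0.
Proof.
have := I_parts (C 1 j).
have -> : (1 - 'X^2) * (C 1 j)^`() - 'X * C 1 j = - j.+1%:R *: T j.+1.
  apply/polyfunP => x.
  (* Differentiating (1 - x^2) C^(1)_j = (T_j - T_(j+2)) / 2 yields (1 - x^2) times the derivative
     of C^(1)_j without a second-order formula. *)
  have := congr1 (fun p => (p^`()).[x]) (subX2_chebyshev_poly j).
  rewrite derivM derivB derivXn derivC derivD !derivZ deriv_chebyshev sub0r.
  rewrite !(hornerD, hornerN, hornerZ, hornerM, hornerX, hornerXn, hornerC, hornerMn).
  move=> E; have {E} -> : (1 - x * x) * (C 1 j)^`().[x] = (x + x) * (C 1 j).[x]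
    + (2^-1 * (T j)^`().[x] + - 2^-1 * (j.+2%:R * (C 1 j.+1).[x])).
    by rewrite -E; ring.
  case: j => [|j].
    by rewrite derivC !hornerC gegenbauer1E chebyshev1E; field.
  have [_ ->] := chebyshev_gegenbauer1 j.+1 x.
  by rewrite deriv_chebyshev hornerZ gegenbauer1_rec; field.
move/eqP; rewrite IZ mulf_eq0 oppr_eq0 pnatr_eq0 /=; exact: eqP.
Qed.

(** One factor 1 - X^2 lowers the parameter by one and keeps both resulting indices positive, so
    induction on k descends to the Chebyshev moments. *)
Lemma weighted_moment k j : weighted k.+1 (C k.+1 j.+1) = 0.
Proof.
rewrite /weighted; elim: k j => [|k ih] j.
  by rewrite expr1 subX2_chebyshev_poly I_linear !chebyshev_moment !mulr0 addr0.
rewrite exprSr -mulrA subX2_gegenbauer_poly mulrDr -!scalerAr I_linear !ih.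
by rewrite !mulr0 addr0.
Qed.

(** Lowering the parameter as above turns 1 = C^(k+2)_0 into a multiple of C^(k+1)_0 plus a term in
    C^(k+1)_2, whose moment is zero. *)
Lemma weighted1 k : weighted k.+1 1 = gegenbauer_norm k.+1 0.
Proof.
rewrite /weighted; elim: k => [|k ih].
  have := subX2_chebyshev_poly 0; rewrite [C 1 0]/= => e.
  rewrite expr1 e I_linear chebyshev_moment mulr0 addr0 [T 0]/= I1.
  rewrite /gegenbauer_norm -[(0 + 2 * 1).-1]/1%N -[1.-1]/0%N fact0 (factS 0).
  by rewrite fact0; field.
have := subX2_gegenbauer_poly k 0; rewrite [C k.+2 0]/= => e.
rewrite exprSr -mulrA e mulrDr -!scalerAr I_linear [C k.+1 0]/= ih.
rewrite [X in _ + _ * X]weighted_moment mulr0 addr0.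
have c0 : 4 * k.+1%:R ^+ 2 * (0 + k.+1%:R + 1) != 0 :> R.
  by rewrite add0r; field_neq0.
by apply: (mulfI c0); have -> := gegenbauer_norm_shift k 0; field; field_neq0.
Qed.

Lemma weighted_gegenbauer_norm k j :
  weighted k.+1 (C k.+1 j * C k.+1 j) = gegenbauer_norm k.+1 j.
Proof.
(* The nonzero entries of column i of the matrix of multiplication by x: [A i] below the diagonal,
   [B i] above it. *)
pose A i : R := i.+1%:R / (2 * (i%:R + k.+1%:R)).
pose B i : R := if i is i'.+1 then (i'%:R + 2 * k.+1%:R) / (2 * (i%:R + k.+1%:R)) else 0.
have ik i : i%:R + k.+1%:R != 0 :> R by rewrite natrS_neq0.
have A0 i : A i != 0 by rewrite mulf_neq0 ?invr_neq0 ?mulf_neq0 ?pnatr_eq0.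
have rec i : 'X * C k.+1 i = A i *: C k.+1 i.+1 + B i *: C k.+1 i.-1.
  apply/polyfunP => x; rewrite hornerD !hornerZ hornerM hornerX.
  case: i => [|i].
    rewrite /A /B !gegenbauer1E !gegenbauer0E; field.
    by field_neq0.
  have E := gegenbauer_rec k.+1 i x.
  rewrite /A /B.
  apply: (@mulfI _ (2 * (i.+1%:R + k.+1%:R))); first by rewrite mulf_neq0 ?pnatr_eq0.
  have -> : 2 * (i.+1%:R + k.+1%:R) * (x * (C k.+1 i.+1).[x]) =
    2 * (i%:R + k.+1%:R + 1) * x * (C k.+1 i.+1).[x] by ring.
  move/eqP: E; rewrite eq_sym subr_eq => /eqP ->; field.
  by field_neq0.
elim: j => [|j ih].
  by rewrite [C _ 0]/= mulr1 weighted1.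
apply: (mulfI (A0 j)).
rewrite (orthogonal_sequence_norm (B := B) (F := weighted k.+1))// ?ih//; last 2 first.
- by move=> a b p q; rewrite /weighted mulrDr -!scalerAr I_linear.
- by move=> i; rewrite [C _ 0]/= mul1r weighted_moment.
have j0 : j.+1%:R * (j%:R + 1 + k.+1%:R) != 0 :> R.
  by rewrite mulf_neq0 ?natr1 ?natrS_neq0 ?pnatr_eq0.
have -> : gegenbauer_norm k.+1 j.+1 = (j%:R + 2 * k.+1%:R) * (j%:R + k.+1%:R)
    / (j.+1%:R * (j%:R + 1 + k.+1%:R)) * gegenbauer_norm k.+1 j.
  by apply: (mulfI j0); rewrite gegenbauer_normS; field; field_neq0.
rewrite /A /B /=; field.
by field_neq0.
Qed.

Lemma chebyshev_norm j : I (T j * T j) = ubasis_norm 0 j.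
Proof.
(* X T_0 = T_1 without a factor 1/2; this exceptional [A 0] is why the squared norm drops from pi to
   pi / 2 after j = 0. *)
pose A i : R := if i is 0 then 1 else 2^-1.
pose B i : R := if i is 0 then 0 else 2^-1.
have A0 i : A i != 0 by case: i => [|i]; rewrite ?oner_neq0// invr_neq0 ?pnatr_eq0.
have rec i : 'X * T i = A i *: T i.+1 + B i *: T i.-1.
  apply/polyfunP => x; rewrite hornerD !hornerZ hornerM hornerX.
  case: i => [|i]; rewrite /A /B.
    by rewrite chebyshev1E chebyshev0E; ring.
  by rewrite chebyshev_rec; field.
elim: j => [|j ih]; first by rewrite [T 0]/= mulr1 I1.
apply: (mulfI (A0 j)).
rewrite (orthogonal_sequence_norm (B := B))// ?ih//; last first.
  by move=> i; rewrite [T 0]/= mul1r chebyshev_moment.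
by rewrite /A /B; case: j {ih} => [|j] /=; field.
Qed.

Lemma weighted_ubasis_norm k j :
  weighted k (ubasis R k j * ubasis R k j) = ubasis_norm k j.
Proof.
case: k => [|k]; last exact: weighted_gegenbauer_norm.
by rewrite /weighted expr0 mul1r chebyshev_norm.
Qed.

End gegenbauer_moments.

(** * Conversion coefficients and norms *)

Section convop_ubasis.
Set Implicit Arguments.
Unset Strict Implicit.
Context {R : realType}.

(** The coefficients come from duality: entry (i, l) of S_k is the w_(k+1)-product of C^(k)_l and
    C^(k+1)_i over the squared norm of C^(k+1)_i, and that product is the w_k-product of C^(k)_l
    with (1 - x^2) C^(k+1)_i. The proof compares explicit coefficients. *)
Lemma subX2_ubasis k i : (1 - 'X^2) * ubasis R k.+1 i = ubasis_norm R k.+1 i *: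
  ((convop R k i i / ubasis_norm R k i) *: ubasis R k i
   + (convop R k i i.+2 / ubasis_norm R k i.+2) *: ubasis R k i.+2).
Proof.
rewrite scalerDr !scalerA.
have i2 : (i.+2 == i) = false by rewrite gtn_eqF.
case: k => [|k].
  have -> : ubasis R 1 i = gegenbauer_poly R 1 i by [].
  have ub0 j : ubasis R 0 j = chebyshev_poly R j by [].
  rewrite !ub0 subX2_chebyshev_poly.
  have -> : ubasis_norm R 1 i = pi / 2.
    rewrite /ubasis_norm /gegenbauer_norm muln1 addn2 -[1.-1]/0%N fact0 factS.
    by rewrite addn1 natrM; field; field_neq0.
  have -> : convop R 0 i i.+2 = - 2^-1 by rewrite /convop/= eqxx i2.
  have -> : convop R 0 i i = if i == 0%N then 1 else 2^-1 by rewrite /convop/= eqxx.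
  have := lt0r_neq0 (pi_gt0 R) => pi0.
  have -> : pi / 2 * (- 2^-1 / ubasis_norm R 0 i.+2) = - 2^-1.
    have -> : ubasis_norm R 0 i.+2 = pi / 2 by [].
    move: (pi : R) pi0 => c c0; field; exact: c0.
  have -> // : pi / 2 * ((if i == 0%N then 1 else 2^-1) / ubasis_norm R 0 i) = 2^-1.
  rewrite /ubasis_norm; move: (pi : R) pi0 => c c0.
  by case: (i) => [|j] /=; field; exact: c0.
have ub j : ubasis R k.+1 j = gegenbauer_poly R k.+1 j by [].
have -> : ubasis R k.+2 i = gegenbauer_poly R k.+2 i by [].
have -> : convop R k.+1 i i = k.+1%:R / (k.+1 + i)%:R by rewrite /convop/= eqxx.
have -> : convop R k.+1 i i.+2 = - (k.+1%:R / (k.+1 + i + 2)%:R).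
  by rewrite /convop/= eqxx i2.
rewrite !ub subX2_gegenbauer_poly.
have ubn k' j : ubasis_norm R k'.+1 j = gegenbauer_norm R k'.+1 j by [].
have g0 : gegenbauer_norm R k.+1 i != 0 by rewrite -ubn ubasis_norm_neq0.
have gS j : gegenbauer_norm R k.+1 j.+1 = (j%:R + 2 * k.+1%:R) * (j%:R + k.+1%:R)
    / (j.+1%:R * (j%:R + 1 + k.+1%:R)) * gegenbauer_norm R k.+1 j.
  have j0 : j.+1%:R * (j%:R + 1 + k.+1%:R) != 0 :> R by field_neq0.
  by apply: (mulfI j0); rewrite gegenbauer_normS; field; field_neq0.
have -> : ubasis_norm R k.+2 i = (i%:R + 2 * k.+1%:R) * (i%:R + 2 * k.+1%:R + 1) *
    (i%:R + k.+1%:R) / (4 * k.+1%:R ^+ 2 * (i%:R + k.+1%:R + 1)) *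
    gegenbauer_norm R k.+1 i.
  have j0 : 4 * k.+1%:R ^+ 2 * (i%:R + k.+1%:R + 1) != 0 :> R by field_neq0.
  by apply: (mulfI j0); rewrite gegenbauer_norm_shift; field; field_neq0.
rewrite !ubn !gS; congr (_ + _); congr (_ *: _); field.
  by rewrite g0; field_neq0.
by rewrite g0; field_neq0.
Qed.

End convop_ubasis.

(** * The Chebyshev weight *)

Section chebyshev_weight.
Set Implicit Arguments.
Unset Strict Implicit.
Context {R : realType}.
Implicit Types (p q : {poly R}) (x : R).

Notation mu := (@lebesgue_measure R).
Local Notation w0 := (@uweight R 0).
Local Notation Do := (`](-1 : R), 1[%classic).
Local Notation D := (`[(-1 : R), 1]%classic).

Lemma subX2_gt0 x : -1 < x -> x < 1 -> 0 < 1 - x ^+ 2.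
Proof. by move=> *; nra. Qed.

Lemma subX2_ge0 x : -1 <= x -> x <= 1 -> 0 <= 1 - x ^+ 2.
Proof. by move=> *; nra. Qed.

Lemma uweight0E x : -1 <= x -> x <= 1 -> w0 x = (Num.sqrt (1 - x ^+ 2))^-1.
Proof.
by move=> x0 x1; rewrite /uweight sub0r powRN powR12_sqrt// subX2_ge0.
Qed.

Lemma uweightE k x : -1 <= x -> x <= 1 ->
  uweight k x = (1 - x ^+ 2) ^+ k * w0 x.
Proof.
move=> x0 x1; have := subX2_ge0 x0 x1; rewrite /uweight.
rewrite le_eqVlt => /predU1P[<-|w_gt0].
  (* At an endpoint the base is 0, and a power of 0 with nonzero exponent, even negative, has the
     value 0, so both sides vanish. *)
  have h0 : - (2^-1) != 0 :> R by rewrite oppr_eq0 invr_eq0 pnatr_eq0.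
  rewrite !powR0 ?mulr0 ?sub0r//.
  case: k => [|k]; first by rewrite sub0r.
  by apply: lt0r_neq0; rewrite -natr1; have := ler0n R k; lra.
by rewrite powRD ?sub0r ?powR_mulrn ?ltW// (gt_eqF w_gt0) implybT.
Qed.

Lemma measurable_uweight k (A : set R) : measurable_fun A (@uweight R k).
Proof.
apply: (measurable_funS measurableT) => //.
apply: (measurableT_comp (measurable_powR _)).
by apply: measurable_funB => //; exact: measurable_funX.
Qed.

Lemma uweight0_continuous x : -1 < x -> x < 1 -> {for x, continuous w0}.
Proof.
move=> x0 x1.
have wx := subX2_gt0 x0 x1.
have cs : (fun y => (Num.sqrt (1 - y ^+ 2))^-1) y @[y --> x] -->
   (Num.sqrt (1 - x ^+ 2))^-1.
  apply: cvgV; first by rewrite gt_eqF// sqrtr_gt0.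
  apply: continuous_comp; last exact: sqrt_continuous.
  by apply: cvgB; [exact: cvg_cst|apply: exprn_continuous].
rewrite /prop_for /continuous_at uweight0E ?ltW//.
apply: cvg_trans cs; apply: near_eq_cvg; near=> y.
rewrite uweight0E//; apply/ltW; near: y; [exact: lt_nbhsr|exact: lt_nbhsl].
Unshelve. all: end_near. Qed.

(* The points [+- c n] exhaust ]-1, 1[ and [acos] is explicit at them. *)
Let c n : R := cos n.+1%:R^-1.

Let c_itv n : (n.+1%:R^-1 : R) \in `[0, pi]%R.
Proof.
rewrite in_itv/= invr_ge0 ler0n/=.
have n1 : n.+1%:R^-1 <= 1 :> R by rewrite invf_le1 ?ler1n// ltr0n.
by apply: (le_trans n1); have := pi_ge2 R; lra.
Qed.

Let c_gt0 n : 0 < c n.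
Proof.
apply: lt_le_trans (@cos1_gt0 R) _; rewrite leNgt ltr_cos ?c_itv//.
  by rewrite -leNgt invf_le1 ?ler1n// ltr0n.
by rewrite in_itv/= ler01 (le_trans _ (pi_ge2 R))// ler1n.
Qed.

Let c_lt1 n : c n < 1.
Proof.
have pi0 : (0 : R) \in `[0, pi]%R by rewrite in_itv/= lexx pi_ge0.
by rewrite /c -[X in _ < X](@cos0 R) (ltr_cos pi0 (c_itv n)) invr_gt0 ltr0n.
Qed.

Let c_cvg1 : c n @[n --> \oo] --> (1 : R).
Proof.
rewrite -[X in _ --> X](@cos0 R).
apply: (@cvg_comp _ _ _ (fun n => n.+1%:R^-1) cos _ (nbhs (0 : R))).
  exact: cvg_harmonic.
exact: continuous_cos.
Qed.

Let acos_c n : acos (c n) = n.+1%:R^-1.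
Proof. exact: cosK. Qed.

Let c_nondecreasing : nondecreasing_seq c.
Proof.
move=> m n mn; rewrite /c leNgt ltr_cos ?c_itv// -leNgt.
by rewrite lef_pV2 ?posrE ?ltr0n// ler_nat.
Qed.

(** The integrand may blow up at both endpoints. The fundamental theorem is used on [- c n, c n],
    and monotone convergence, available because f >= 0, passes to the limit. *)
Lemma ge0_FTC_oo (f F : R -> R) (l0 l1 : R) :
  (forall x, -1 < x -> x < 1 -> 0 <= f x) ->
  (forall x, -1 < x -> x < 1 -> {for x, continuous f}) ->
  (forall x, -1 < x -> x < 1 -> is_derive x 1 F (f x)) ->
  F (- c n) @[n --> \oo] --> l0 -> F (c n) @[n --> \oo] --> l1 ->
  (\int[mu]_(x in D) (f x)%:E = (l1 - l0)%:E)%E.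
Proof.
move=> f0 cf dF Fl0 Fl1.
pose A n := `[- c n, c n]%classic.
have cN n : -1 < - c n by rewrite ltrN2 c_lt1.
have UA : \bigcup_n A n = Do.
  apply/seteqP; split => x /=.
    move=> [n _]; rewrite /A/= !in_itv/= => /andP[h1 h2].
    by rewrite (lt_le_trans (cN n) h1) (le_lt_trans h2 (c_lt1 n)).
  rewrite in_itv/= => /andP[x1 x2].
  have : `|x| < 1 by rewrite ltr_norml x1.
  move/(cvgr_gt _ c_cvg1) => [n _ /(_ n (leqnn n))/= xn].
  by exists n => //; rewrite /A/= in_itv/= -ler_norml ltW.
have mf : measurable_fun Do f.
  apply: open_continuous_measurable_fun => // x.
  by rewrite inE/= in_itv/= => /andP[]; exact: cf.
rewrite integral_itv_bndoo; last exact/measurable_EFinP.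
have AS n : A n `<=` Do by rewrite -UA; exact: bigcup_sup.
have lim1 : (\int[mu]_(x in A n) (f x)%:E)%E @[n --> \oo] -->
    (\int[mu]_(x in Do) (f x)%:E)%E.
  rewrite -UA; apply: ge0_nondecreasing_set_cvg_integral => //.
  - move=> m n mn; rewrite subsetEset => x; rewrite /A/= !in_itv/= => /andP[h1 h2].
    have := c_nondecreasing mn => cmn.
    by rewrite (le_trans h2 cmn) (le_trans _ h1)// lerN2.
  - by move=> n; exact: measurable_itv.
  - move=> n; apply/measurable_EFinP; apply: measurable_funS mf => //.
  - move=> n x /AS /=; rewrite in_itv/= => /andP[? ?]; rewrite lee_fin.
    exact: f0.
have lim2 : (\int[mu]_(x in A n) (f x)%:E)%E @[n --> \oo] --> (l1 - l0)%:E.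
  have E n : (\int[mu]_(x in A n) (f x)%:E = (F (c n) - F (- c n))%:E)%E.
    have dFx x : -1 < x -> x < 1 -> {for x, continuous F}.
      move=> x0 x1; apply/differentiable_continuous/derivable1_diffP.
      by have [] := dF x x0 x1.
    rewrite /A (@continuous_FTC2 _ f F)//.
    - by rewrite (lt_trans _ (c_gt0 n))// oppr_lt0.
    - apply: continuous_in_subspaceT => x; rewrite inE => /AS /=.
      by rewrite in_itv/= => /andP[]; exact: cf.
    - split.
      + move=> x; rewrite in_itv/= => /andP[h1 h2].
        by have [] := dF x (lt_trans (cN n) h1) (lt_trans h2 (c_lt1 n)).
      + apply: cvg_at_right_filter; apply: dFx => //.
        by rewrite (lt_trans _ (lt_trans (c_gt0 n) (c_lt1 n)))// oppr_lt0.
      + apply: cvg_at_left_filter; apply: dFx => //.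
        by rewrite (lt_trans _ (c_gt0 n))// ltrN10.
    - move=> x; rewrite in_itv/= => /andP[h1 h2]; rewrite derive1E.
      by have [_] := dF x (lt_trans (cN n) h1) (lt_trans h2 (c_lt1 n)).
  under eq_cvg do rewrite E.
  by apply: cvg_EFin; [exact: nearW|apply: cvgB].
by rewrite -(cvg_unique _ lim1 lim2).
Qed.

(** The primitive - acos of w_0 runs from - pi to 0. *)
Lemma integral_uweight0 : (\int[mu]_(x in D) (w0 x)%:E = pi%:E)%E.
Proof.
have := @ge0_FTC_oo w0 (fun x => - acos x) (- pi) 0.
rewrite sub0r opprK; apply.
- by move=> x _ _; exact: powR_ge0.
- exact: uweight0_continuous.
- move=> x x0 x1; rewrite uweight0E ?ltW// -[_^-1]opprK.
  by apply: is_deriveN; apply: is_derive1_acos; rewrite x0.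
- rewrite (_ : (fun n => _) = fun n => - (pi - n.+1%:R^-1)); last first.
    apply/funext => n; rewrite acosN ?acos_c// (ltW (c_lt1 n)).
    by rewrite (le_trans _ (ltW (c_gt0 n)))// lerN10.
  rewrite -[X in _ --> - X]subr0.
  by apply: cvgN; apply: cvgB; [exact: cvg_cst|exact: cvg_harmonic].
- rewrite (_ : (fun n => _) = fun n => - n.+1%:R^-1); last first.
    by apply/funext => n; rewrite acos_c.
  by rewrite -oppr0; apply: cvgN; exact: cvg_harmonic.
Qed.

Lemma integrable_uweight0 : mu.-integrable D (EFin \o w0).
Proof.
apply/integrableP; split; first by apply/measurable_EFinP; exact: measurable_uweight.
under eq_integral do rewrite /= ger0_norm ?powR_ge0//.
by rewrite integral_uweight0 ltry.
Qed.

(** Here h w_k = (h (1 - x^2)^k) w_0 is a function continuous on a compact interval, hence bounded,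
    times the integrable w_0. *)
Lemma integrable_mul_uweight k (h : R -> R) : {within D, continuous h} ->
  mu.-integrable D (EFin \o (fun x => h x * uweight k x)).
Proof.
move=> ch.
have cp : {within D, continuous (horner ((1 - 'X^2) ^+ k : {poly R}))}.
  by apply: continuous_subspaceT; exact: continuous_horner.
have cg : {within D, continuous (fun x => h x * ((1 - 'X^2) ^+ k).[x])}.
  by move=> x; apply: cvgM; [exact: ch|exact: cp].
have bg : [bounded (h x * ((1 - 'X^2) ^+ k).[x] : R^o) | x in D].
  have /compact_bounded[M [_ mrt]] :=
    @continuous_compact _ _ (_ : R -> R^o) _ cg (@segment_compact _ _ _).
  by exists M; split; rewrite ?num_real // => y My x Dx; apply: (mrt y My); exists x.
have mg := subspace_continuous_measurable_fun (measurable_itv _) cg.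
have mD : measurable D by exact: measurable_itv.
have := @integrableMr _ _ _ mu _ mD _ _ mg bg integrable_uweight0.
apply: eq_integrable => // x; rewrite inE/= in_itv/= => /andP[x0 x1].
have -> : from_subspace D (fun y => h y * ((1 - 'X^2) ^+ k).[y]) x =
  h x * ((1 - 'X^2) ^+ k).[x] by [].
by rewrite horner_exp hornerD hornerN hornerXn hornerC (@uweightE k)// -EFinM mulrA.
Qed.

Lemma is_derive_sqrt_subX2 x : -1 < x -> x < 1 ->
  is_derive x 1 (fun y => Num.sqrt (1 - y ^+ 2)) (- x * w0 x).
Proof.
move=> x0 x1; have wx := subX2_gt0 x0 x1.
have -> : (fun y : R => Num.sqrt (1 - y ^+ 2)) = Num.sqrt \o horner (1 - 'X^2).
  by apply/funext => y /=; rewrite hornerD hornerN hornerXn hornerC.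
have E : (1 - 'X^2 : {poly R}).[x] = 1 - x ^+ 2.
  by rewrite hornerD hornerN hornerXn hornerC.
have w1 : 0 < (1 - 'X^2 : {poly R}).[x] by rewrite E.
have d := is_derive1_comp (is_derive1_sqrt w1) (is_derive_poly (1 - 'X^2) x).
apply: (trigger_derive d).
rewrite E derivB derivC derivXn sub0r hornerN hornerMn hornerX uweight0E ?ltW//.
by field; rewrite gt_eqF// sqrtr_gt0.
Qed.

(* The integrand is the derivative of [sqrt (1 - x^2) p x]. Adding a multiple of
   the weight makes it nonnegative, so that [ge0_FTC_oo] applies. *)
Lemma integral_by_parts p :
  \int[mu]_(x in D) (((1 - 'X^2) * p^`() - 'X * p).[x] * w0 x) = 0.
Proof.
set q := _ - _.
(* [M] is minus the minimum of q on [-1, 1]. *)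
have [M qM] : exists M : R, forall x, D x -> - M <= q.[x].
  have [||y yD qy] := @EVT_min R (horner q) (-1) 1; first by rewrite (le_trans (lerN10 _)).
    by apply: continuous_subspaceT; exact: continuous_horner.
  by exists (- q.[y]) => x xD; rewrite opprK qy.
pose G x := Num.sqrt (1 - x ^+ 2) * p.[x].
have cG : continuous G.
  move=> x; apply: cvgM; last exact: continuous_horner.
  apply: (@cvg_comp _ _ _ (fun y => 1 - y ^+ 2) Num.sqrt _ (nbhs (1 - x ^+ 2))).
    by apply: cvgB; [exact: cvg_cst|exact: exprn_continuous].
  exact: sqrt_continuous.
(* The primitive is [G] - M acos. As [G] vanishes at both endpoints, only M acos contributes, namely
   M pi; the integral of M w_0 is also M pi, so that of q w_0 is 0. *)
have main : (\int[mu]_(x in D) ((q.[x] + M) * w0 x)%:E = (M * pi)%:E)%E.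
  have := @ge0_FTC_oo (fun x => (q.[x] + M) * w0 x)
    (fun x => G x - M * acos x) (- (M * pi)) 0.
  rewrite sub0r opprK; apply.
  - move=> x x0 x1; rewrite mulr_ge0 ?powR_ge0// -lerBlDr sub0r qM//=.
    by rewrite in_itv/= !ltW.
  - move=> x x0 x1; apply: cvgM; last exact: uweight0_continuous.
    by apply: cvgD; [exact: continuous_horner|exact: cvg_cst].
  - move=> x x0 x1.
    have dG := is_deriveM (is_derive_sqrt_subX2 x0 x1) (is_derive_poly p x).
    have dA : is_derive x 1 (@acos R) (- (Num.sqrt (1 - x ^+ 2))^-1).
      by apply: is_derive1_acos; rewrite x0.
    have d := is_deriveB dG (is_deriveZ M dA).
    apply: (trigger_derive d).
    rewrite -uweight0E ?ltW// /q hornerD hornerN !hornerM hornerD hornerN.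
    rewrite hornerX hornerXn hornerC.
    have -> : Num.sqrt (1 - x ^+ 2) = (1 - x ^+ 2) * w0 x.
      rewrite uweight0E ?ltW// -[X in X / _]sqr_sqrtr ?subX2_ge0 ?ltW//.
      by rewrite expr2 mulfK// gt_eqF// sqrtr_gt0 subX2_gt0.
    rewrite /GRing.scale/=; ring.
  - have -> : - (M * pi) = G (- 1) - M * (pi - 0).
      by rewrite /G sqrrN expr1n subrr sqrtr0 mul0r subr0 sub0r.
    rewrite (_ : (fun n => _) = fun n => G (- c n) - M * (pi - n.+1%:R^-1)); last first.
      apply/funext => n; rewrite acosN ?acos_c// (ltW (c_lt1 n)).
      by rewrite (le_trans _ (ltW (c_gt0 n)))// lerN10.
    apply: cvgB.
      apply: (@cvg_comp _ _ _ (fun n => - c n) G _ (nbhs (- 1 : R))).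
        exact: cvgN.
      exact: cG.
    apply: cvgM; first exact: cvg_cst.
    by apply: cvgB; [exact: cvg_cst|exact: cvg_harmonic].
  - have -> : 0 = G 1 - M * 0 by rewrite /G expr1n subrr sqrtr0 mul0r mulr0 subr0.
    rewrite (_ : (fun n => _) = fun n => G (c n) - M * n.+1%:R^-1); last first.
      by apply/funext => n; rewrite acos_c.
    apply: cvgB.
      apply: (@cvg_comp _ _ _ c G _ (nbhs (1 : R))); first exact: c_cvg1.
      exact: cG.
    by apply: cvgM; [exact: cvg_cst|exact: cvg_harmonic].
have iq : mu.-integrable D (EFin \o (fun x => q.[x] * w0 x)).
  by apply: integrable_mul_uweight; apply: continuous_subspaceT; exact: continuous_horner.
have : \int[mu]_(x in D) ((q.[x] + M) * w0 x) = M * pi by rewrite /Rintegral main.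
have mD : measurable D by exact: measurable_itv.
under eq_Rintegral do rewrite mulrDl.
rewrite RintegralD//; last first.
  have := @integrableZl _ _ _ mu _ mD M _ integrable_uweight0.
  by apply: eq_integrable.
rewrite RintegralZl//; last exact: integrable_uweight0.
by rewrite {2}/Rintegral integral_uweight0/= -[RHS]add0r => /addIr.
Qed.

End chebyshev_weight.

(** * Inner products and expansion coefficients *)

Section inner_product.
Set Implicit Arguments.
Unset Strict Implicit.
Context {R : realType}.
Implicit Types (p q : {poly R}) (x : R) (f g : R -> R).

Notation mu := (@lebesgue_measure R).
Local Notation D := (`[(-1 : R), 1]%classic).

Let continuous_within_horner p : {within D, continuous (horner p)}.
Proof. by apply: continuous_subspaceT; exact: continuous_horner. Qed.

Lemma continuous_within_mul_horner f p : {within D, continuous f} ->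
  {within D, continuous (fun x => f x * p.[x])}.
Proof. by move=> cf x; apply: cvgM; [exact: cf|exact: continuous_within_horner]. Qed.

Let integrable_uinner k f p : {within D, continuous f} ->
  mu.-integrable D (EFin \o (fun x => f x * p.[x] * uweight k x)).
Proof.
move=> cf; apply: (@integrable_mul_uweight _ k (fun x => f x * p.[x])).
exact: continuous_within_mul_horner.
Qed.

Lemma eq_uinner k f f' g : (forall x, D x -> f x = f' x) ->
  uinner k f g = uinner k f' g.
Proof.
by move=> ff'; apply: eq_Rintegral => x; rewrite inE => Dx; rewrite ff'.
Qed.

Lemma uinnerDr k f a b p q : {within D, continuous f} ->
  uinner k f (horner (a *: p + b *: q)) =
  a * uinner k f (horner p) + b * uinner k f (horner q).
Proof.
move=> cf; have mD : measurable D by exact: measurable_itv.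
have iz c r : mu.-integrable D (EFin \o (fun x => c * (f x * r.[x] * uweight k x))).
  have := @integrableZl _ _ _ mu _ mD c _ (@integrable_uinner k f r cf).
  exact: eq_integrable.
rewrite /uinner -!RintegralZl//; try exact: integrable_uinner.
rewrite -RintegralD//; apply: eq_Rintegral => x _.
by rewrite hornerD !hornerZ; ring.
Qed.

Lemma uinnerC k f g : uinner k f g = uinner k g f.
Proof. by apply: eq_Rintegral => x _; rewrite [f x * _]mulrC. Qed.

Lemma uinner_sumr k f (I : finType) (c : I -> R) (p : I -> {poly R}) :
  {within D, continuous f} ->
  uinner k f (horner (\sum_i c i *: p i)) = \sum_i c i * uinner k f (horner (p i)).
Proof.
move=> cf.
have : uinner k f (horner 0) = 0.
  have := @uinnerDr k f 0 0 0 0 cf.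
  by rewrite !scaler0 addr0 !mul0r addr0.
move=> u0; elim/big_rec2: _ => [//|i y z _ <-].
by rewrite -[z]scale1r uinnerDr// mul1r scale1r.
Qed.

Lemma uinnerDl k f g a b p : {within D, continuous f} -> {within D, continuous g} ->
  uinner k (fun x => a * f x + b * g x) (horner p) =
  a * uinner k f (horner p) + b * uinner k g (horner p).
Proof.
move=> cf cg; have mD : measurable D by exact: measurable_itv.
have iz (c : R) (h : R -> R) : {within D, continuous h} ->
    mu.-integrable D (EFin \o (fun x => c * (h x * p.[x] * uweight k x))).
  move=> ch; have := @integrableZl _ _ _ mu _ mD c _ (@integrable_uinner k h p ch).
  exact: eq_integrable.
rewrite /uinner -!RintegralZl//; try exact: integrable_uinner.
rewrite -RintegralD//; try exact: iz.
by apply: eq_Rintegral => x _; ring.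
Qed.

Lemma uinnerZl k f a p : {within D, continuous f} ->
  uinner k (fun x => a * f x) (horner p) = a * uinner k f (horner p).
Proof.
move=> cf; have := uinnerDl k a 0 p cf cf; rewrite mul0r addr0 => <-.
by apply: eq_uinner => x _; rewrite mul0r addr0.
Qed.

(** Continuity is part of the conclusion because additivity, at each step of the induction, needs
    the partial sum to be continuous. *)
Lemma uinner_suml k (I : finType) (c : I -> R) (g : I -> R -> R) p :
  (forall i, {within D, continuous (g i)}) ->
  {within D, continuous (fun x => \sum_i c i * g i x)} /\
  uinner k (fun x => \sum_i c i * g i x) (horner p) =
  \sum_i c i * uinner k (g i) (horner p).
Proof.
move=> cg; elim: (index_enum I) => [|i r [ihc ihs]].
  rewrite (_ : (fun x => _) = fun=> 0); last by apply/funext => x; rewrite big_nil.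
  have c0 : {within D, continuous (fun=> 0 : R)} by move=> x; exact: cvg_cst.
  split=> //; have := uinnerDl k 0 0 p c0 c0.
  by rewrite big_nil !mul0r addr0.
rewrite (_ : (fun x => _) = fun x => c i * g i x +
    1 * \sum_(i0 <- r) c i0 * g i0 x); last first.
  by apply/funext => x; rewrite big_cons mul1r.
rewrite uinnerDl// big_cons ihs mul1r; split => // x.
by apply: cvgD; apply: cvgM; [exact: cvg_cst|exact: cg|exact: cvg_cst|exact: ihc].
Qed.

(** The abstract functional becomes p |-> [uinner 0 1 p]: [integral_uweight0] gives its value at 1
    and [integral_by_parts] the remaining hypothesis. *)
Lemma uinner_ubasis_norm k j :
  uinner k (horner (ubasis R k j)) (horner (ubasis R k j)) = ubasis_norm R k j.
Proof.
pose I p := uinner 0 (horner 1) (horner p).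
have Ilin a b p q : I (a *: p + b *: q) = a * I p + b * I q by exact: uinnerDr.
rewrite -(weighted_ubasis_norm Ilin).
- apply: eq_Rintegral => x; rewrite inE/= in_itv/= => /andP[x0 x1].
  rewrite (@uweightE _ k)// hornerC mul1r !hornerM horner_exp hornerD hornerN.
  rewrite hornerXn hornerC.
  by ring.
- rewrite /I /uinner.
  under eq_Rintegral do rewrite hornerC !mul1r.
  by rewrite /Rintegral integral_uweight0.
- move=> p; rewrite /I /uinner.
  under eq_Rintegral do rewrite hornerC mul1r.
  exact: integral_by_parts.
Qed.

(** The factor 1 - x^2 by which w_(k+1) exceeds w_k is moved onto the basis polynomial, where
    [subX2_ubasis] expands it. *)
Lemma uinner_ubasisS k f i : {within D, continuous f} ->
  uinner k.+1 f (horner (ubasis R k.+1 i)) = ubasis_norm R k.+1 i *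
    (convop R k i i / ubasis_norm R k i * uinner k f (horner (ubasis R k i)) +
     convop R k i i.+2 / ubasis_norm R k i.+2 *
       uinner k f (horner (ubasis R k i.+2))).
Proof.
move=> cf; transitivity (uinner k f (horner ((1 - 'X^2) * ubasis R k.+1 i))).
  apply: eq_Rintegral => x; rewrite inE/= in_itv/= => /andP[x0 x1].
  rewrite (@uweightE _ k.+1)// (@uweightE _ k)// exprS.
  by rewrite hornerM hornerD hornerN hornerXn hornerC; ring.
by rewrite subX2_ubasis scalerDr !scalerA uinnerDr// mulrDr !mulrA.
Qed.

Lemma ucoefS k f i : {within D, continuous f} ->
  ucoef k.+1 f i =
  convop R k i i * ucoef k f i + convop R k i i.+2 * ucoef k f i.+2.
Proof.
move=> cf; rewrite /ucoef !uinner_ubasis_norm uinner_ubasisS//.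
by rewrite mulrAC divff ?ubasis_norm_neq0// mul1r !mulrA ![_ / _ * _]mulrAC.
Qed.

End inner_product.

(** * Operators *)

Section infinite_matrices.
Set Implicit Arguments.
Unset Strict Implicit.
Context {R : realType}.

Lemma limn_series_finite (u : R^nat) m : (forall l, (m <= l)%N -> u l = 0) ->
  limn (series u) = \sum_(l < m) u l.
Proof.
move=> u0; apply: cvg_lim => //; apply: cvg_near_cst.
exists m => // n/= mn.
rewrite /series/= (big_cat_nat (n := m))//= big_mkord.
rewrite [X in _ + X]big_nat_cond [X in _ + X]big1 ?addr0// => l.
by move=> /andP[/andP[ml _] _]; exact: u0.
Qed.

Lemma infmx_mul_row_finite (A B : infmx R) i j m :
  (forall l, (m <= l)%N -> A i l = 0) ->
  infmx_mul A B i j = \sum_(l < m) A i l * B l j.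
Proof.
by move=> A0; apply: limn_series_finite => l ml; rewrite A0// mul0r.
Qed.

End infinite_matrices.

(** * Operators acting on coefficients *)

Section ultraspherical_operator.
Set Implicit Arguments.
Unset Strict Implicit.
Context {R : realType}.
Local Notation D := (`[(-1 : R), 1]%classic).

(** Column j of [diffop R k] has at most one nonzero entry, in row j - k, so the series is a single
    term, and [derivn_chebyshev] identifies it. *)
Lemma multop_diffop k (a : R -> R) i j : {within D, continuous a} ->
  infmx_mul (multop k a) (diffop R k) i j =
  ucoef k (fun x => a x * ((chebyshev_poly R j)^`(k)).[x]) i.
Proof.
move=> ca; rewrite /infmx_mul (@limn_series_finite _ _ j.+1) => [|l jl]; last first.
  rewrite /diffop /infmx1; case: ifP => _.
    by rewrite gtn_eqF ?mulr0.
  by rewrite ltn_eqF ?mulr0// (leq_trans jl)// leq_addr.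
case: k => [|k].
  rewrite (bigD1 ord_max)//= big1 => [|l lj]; last first.
    by rewrite /diffop/= /infmx1 (_ : (_ == _) = false) ?mulr0//; apply/negbTE.
  by rewrite /diffop/= /infmx1 eqxx mulr1 addr0.
rewrite derivn_chebyshev; case: (ltnP k j) => [kj|jk].
  have lj : (j - k.+1 < j.+1)%N by rewrite ltnS leq_subr.
  rewrite (bigD1 (Ordinal lj))//= big1 => [|l]; last first.
    move/eqP => lj'; rewrite /diffop/= ifF ?mulr0//; apply/eqP => jE.
    apply: lj'; apply/val_inj => /=.
    by rewrite [X in _ = (X - _)%N]jE addnK.
  rewrite /diffop/= subnK// eqxx addr0 /multop /ucoef mulrAC; congr (_ / _).
  have cf : {within D, continuous (fun x => a x * (ubasis R k.+1 (j - k.+1)).[x])}.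
    exact: continuous_within_mul_horner.
  rewrite mulrC -uinnerZl//; apply: eq_uinner => x _.
  by rewrite hornerZ; ring.
rewrite big1 => [|l _]; last first.
  rewrite /diffop/= ifF ?mulr0//; apply/negbTE; rewrite ltn_eqF//.
  by rewrite addnS ltnS (leq_trans jk)// leq_addl.
rewrite /ucoef (@eq_uinner _ _ _ (fun x => 0 * a x)).
  by rewrite uinnerZl// !mul0r.
by move=> x _; rewrite horner0 mulr0 mul0r.
Qed.

Lemma convop_eq0 k (i j : nat) : (j != i)%N -> (j != i.+2)%N -> convop R k i j = 0.
Proof. by move=> /negPf ji /negPf ji2; rewrite /convop; case: ifP => _; rewrite ji ji2. Qed.

Lemma convop_prodS N k : (k <= N)%N ->
  convop_prod R N.+1 k = infmx_mul (convop R N) (convop_prod R N k).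
Proof.
move=> kN; rewrite /convop_prod /index_iota subSn// -addn1 iotaD rev_cat big_cons.
by rewrite subnKC.
Qed.

Lemma infmx_mul_convop k (B : infmx R) i j :
  infmx_mul (convop R k) B i j =
  convop R k i i * B i j + convop R k i i.+2 * B i.+2 j.
Proof.
rewrite (@infmx_mul_row_finite _ _ _ _ _ i.+3); last first.
  by move=> l il; rewrite convop_eq0// gtn_eqF// ltnW// ltnW.
rewrite 3!big_ord_recr/= big1 ?add0r => [|l _]; last first.
  by rewrite convop_eq0 ?mul0r// ltn_eqF// ?ltnS// ltnW// ltnS ltnW.
have i1 : (i.+1 != i)%N by rewrite gtn_eqF.
have i2 : (i.+1 != i.+2)%N by rewrite ltn_eqF.
by rewrite (convop_eq0 k i1 i2) mul0r addr0.
Qed.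

Lemma convop_prod_id k : convop_prod R k k = @infmx1 R.
Proof. by rewrite /convop_prod /index_iota subnn big_nil. Qed.

Lemma infmx1_mul (X : infmx R) i j : infmx_mul (@infmx1 R) X i j = X i j.
Proof.
rewrite (@infmx_mul_row_finite _ _ _ _ _ i.+1) => [|l il]; last first.
  by rewrite /infmx1 ltn_eqF.
rewrite (bigD1 ord_max)//= big1 => [|l lj]; last first.
  by rewrite /infmx1 (_ : (_ == _) = false) ?mul0r//; apply/negbTE; rewrite eq_sym.
by rewrite /infmx1 eqxx mul1r addr0.
Qed.

(** By [infmx_mul_convop], row i of the longer product combines rows i and i.+2 of the shorter one,
    so the larger of their two bounds works. *)
Lemma convop_prod_row_finite N k i : (k <= N)%N ->
  exists m, forall l, (m <= l)%N -> convop_prod R N k i l = 0.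
Proof.
have base n i' : exists m, forall l, (m <= l)%N -> convop_prod R n n i' l = 0.
  by exists i'.+1 => l il; rewrite convop_prod_id /infmx1 ltn_eqF.
elim: N i => [|N ih] i; first by rewrite leqn0 => /eqP ->.
rewrite leq_eqVlt => /predU1P[->//|].
rewrite ltnS => kN; have [m1 m1P] := ih i kN; have [m2 m2P] := ih i.+2 kN.
exists (maxn m1 m2) => l; rewrite geq_max => /andP[m1l m2l].
by rewrite convop_prodS// infmx_mul_convop m1P// m2P// !mulr0 addr0.
Qed.

(* The columns of [X] are infinite; only the row finiteness of the conversion
   operators makes the products associate. *)
Lemma convop_prod_ucoef N k (f : R -> R) (X : infmx R) i j : (k <= N)%N ->
  {within D, continuous f} ->
  (forall l, X l j = ucoef k f l) ->
  infmx_mul (convop_prod R N k) X i j = ucoef N f i.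
Proof.
move=> + cf XE; elim: N i => [|N ih] i.
  by rewrite leqn0 => /eqP k0; rewrite k0 convop_prod_id infmx1_mul -k0.
rewrite leq_eqVlt => /predU1P[<-|]; first by rewrite convop_prod_id infmx1_mul.
rewrite ltnS => kN.
have [m1 m1P] := convop_prod_row_finite i kN.
have [m2 m2P] := convop_prod_row_finite i.+2 kN.
rewrite ucoefS// -(ih i kN) -(ih i.+2 kN).
(* One truncation common to rows i and i.+2 turns all three limits into finite sums over the same
   range, where distributivity suffices. *)
rewrite !(@infmx_mul_row_finite _ _ _ _ _ (maxn m1 m2)).
- rewrite !mulr_sumr -big_split/=; apply: eq_bigr => l _.
  by rewrite convop_prodS// infmx_mul_convop mulrDl !mulrA.
- by move=> l; rewrite geq_max => /andP[_ ?]; exact: m2P.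
- by move=> l; rewrite geq_max => /andP[? _]; exact: m1P.
- move=> l; rewrite geq_max => /andP[? ?].
  by rewrite convop_prodS// infmx_mul_convop m1P// m2P// !mulr0 addr0.
Qed.

End ultraspherical_operator.

(** * The Gamma function at positive integers *)

Section gamma.
Set Implicit Arguments.
Unset Strict Implicit.
Context {R : realType}.

(** From exp x >= x^(n+1) / (n+1)! for x > 0 follows x^n exp (- x) <= (n+1)! / x. *)
Lemma cvg_exprn_expRN n : x ^+ n * expR (- x) @[x --> +oo] --> (0 : R).
Proof.
have f0 : 0 < n.+1`!%:R :> R by rewrite ltr0n fact_gt0.
apply/cvgrPdist_lt => e e0; near=> x.
have x0 : 0 < x by near: x; exact: nbhs_pinfty_gt.
rewrite sub0r normrN ger0_norm ?mulr_ge0 ?expR_ge0 ?exprn_ge0 ?ltW//.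
apply: (@le_lt_trans _ _ (n.+1`!%:R / x)).
  rewrite ler_pdivlMr// expRN mulrAC -exprSr ler_pdivrMr ?expR_gt0//.
  rewrite -ler_pdivrMl// mulrC; apply: le_trans (expR_ge1Dxn n (ltW x0)).
  by rewrite lerDr.
rewrite ltr_pdivrMr// -ltr_pdivrMl// mulrC.
by near: x; apply: nbhs_pinfty_gt; rewrite num_real.
Unshelve. all: end_near. Qed.

(* [- gamma_poly n * exp (- x)] is a primitive of [x ^ n * exp (- x)]. *)
Fixpoint gamma_poly n : {poly R} :=
  if n is m.+1 then 'X^n + n%:R *: gamma_poly m else 1.

(** This is the primitive property, since the derivative of - p exp (- x) is (p - p') exp (- x). *)
Lemma gamma_polyB n : gamma_poly n - (gamma_poly n)^`() = 'X^n.
Proof.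
elim: n => [|n ih]; first by rewrite /= derivC subr0 expr0.
rewrite [gamma_poly _]/= derivD derivZ derivXn opprD addrACA -scalerBr ih.
by rewrite -addrA scaler_nat addNr addr0.
Qed.

Lemma gamma_poly0 n : (gamma_poly n).[0] = n`!%:R.
Proof.
elim: n => [|n ih]; first by rewrite hornerC fact0.
by rewrite hornerD hornerZ hornerXn expr0n ih add0r factS natrM.
Qed.

Lemma cvg_gamma_poly n : (gamma_poly n).[x] * expR (- x) @[x --> +oo] --> (0 : R).
Proof.
elim: n => [|n ih].
  by under eq_cvg => x do rewrite hornerC -(expr0 x); exact: cvg_exprn_expRN.
rewrite (_ : (fun x => _) = (fun x => x ^+ n.+1 * expR (- x)
    + n.+1%:R * ((gamma_poly n).[x] * expR (- x)))); last first.
  by apply/funext => x; rewrite hornerD hornerZ hornerXn mulrDl mulrA.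
rewrite -[X in _ --> X]add0r -[X in _ --> _ + X](mulr0 n.+1%:R).
by apply: cvgD; [exact: cvg_exprn_expRN|apply: cvgM => //; exact: cvg_cst].
Qed.

(** The explicit primitive [F] tends to 0 at infinity and equals - n! at 0, so no functional
    equation for Gamma is required. *)
Lemma GammaS n : Gamma n.+1%:R = n`!%:R :> R.
Proof.
pose f (x : R) := x ^+ n * expR (- x).
pose F (x : R) := - ((gamma_poly n).[x] * expR (- x)).
have cf : continuous f.
  move=> x; apply: cvgM; first exact: exprn_continuous.
  apply: (@cvg_comp _ _ _ -%R expR _ (nbhs (- x))); last exact: continuous_expR.
  exact: opp_continuous.
have dF (x : R) : is_derive x 1 F (f x).
  have dE : is_derive x 1 (fun y : R => expR (- y)) (- expR (- x)).
    have dN : is_derive x 1 (-%R : R -> R) (- 1) by exact: is_deriveN.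
    by have := is_derive1_comp (is_derive_expR (- x)) dN; rewrite mulrN1.
  have d := is_deriveN (is_deriveM (is_derive_poly (gamma_poly n) x) dE).
  apply: (trigger_derive d).
  have := congr1 (horner^~ x) (gamma_polyB n).
  rewrite hornerD hornerN hornerXn /f => <-.
  by rewrite /GRing.scale/=; ring.
have cF : continuous F.
  move=> x; apply/differentiable_continuous/derivable1_diffP.
  by have [] := dF x.
rewrite /Gamma.
transitivity (\int[lebesgue_measure]_(x in `]0%R, +oo[) f x).
  apply: eq_Rintegral => x; rewrite inE/= in_itv/= andbT => x0.
  by rewrite /f -natr1 addrK powR_mulrn// ltW.
rewrite /Rintegral integral_itv_obnd_cbnd; last first.
  apply/measurable_EFinP; apply: measurable_funTS; exact: continuous_measurable_fun.
rewrite (@ge0_continuous_FTC2y _ f F 0 0).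
- by rewrite /F oppr0 expR0 mulr1 gamma_poly0 -EFinB/= sub0r opprK.
- by move=> x x0; rewrite mulr_ge0 ?expR_ge0 ?exprn_ge0.
- exact: continuous_subspaceT.
- by rewrite -oppr0; apply: cvgN; exact: cvg_gamma_poly.
- by move=> x _; have [] := dF x.
- by apply: cvg_at_right_filter; exact: cF.
- by move=> x _; rewrite derive1E; have [] := dF x.
Qed.

Lemma dnormE N j : (0 < N)%N -> dnorm R N j = ubasis_norm R N j.
Proof.
case: N => // N _; rewrite /dnorm /ubasis_norm /gegenbauer_norm.
have -> : (2 : R) ^ (1 - (2 * N.+1)%:Z) = 2 / 4 ^+ N.+1.
  rewrite expfzDr ?pnatr_eq0// expr1z -exprnN exprM.
  by congr (_ / _ ^+ _); rewrite expr2 -natrM.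
have -> : (j + 2 * N.+1)%N = (j + 2 * N.+1).-1.+1 by rewrite mulnS addnS.
by rewrite !GammaS succnK mulrA.
Qed.

End gamma.

(** Only the first difference quotient matters: f y = f x + quotient (y - x), and the second factor
    tends to 0. *)
Lemma smooth_on_continuous (R : realType) (D : set R) (f : R -> R) :
  smooth_on D f -> {within D, continuous f}.
Proof.
move=> [g [gf dg]]; apply/subspace_continuousP => x Dx.
have h : f y @[y --> within D x^'] --> f x.
  rewrite -[X in _ --> X]addr0 -[X in _ --> _ + X](mulr0 (g 1%N x)).
  have lim : f x + (g 0%N y - g 0%N x) / (y - x) * (y - x) @[y --> within D x^'] -->
      f x + g 1%N x * 0.
    apply: cvgD; first exact: cvg_cst.
    apply: cvgM; first exact: dg.
    rewrite -[X in _ --> X](subrr x); apply: cvgB; last exact: cvg_cst.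
    by apply: cvg_trans (@cvg_within _ _ _ _) _; exact: cvg_within.
  apply: cvg_trans lim; apply: near_eq_cvg; rewrite near_withinE; near=> y => Dy.
  have yx : y != x by near: y; exact: nbhs_dnbhs_neq.
  by rewrite divfK ?subr_eq0// !gf//; ring.
(* The limit so far is over the punctured neighbourhood; at y = x the distance is 0, so the point
   can be restored. *)
apply/cvgrPdist_lt => e e0.
have /cvgrPdist_lt/(_ e e0) h' := h.
have {}h' : \forall y \near x, y != x -> D y -> `|f x - f y| < e := h'.
suff : \forall y \near x, D y -> `|f x - f y| < e by [].
apply: filterS h' => y hy Dy.
have [->|yx] := eqVneq y x; first by rewrite subrr normr0.
exact: hy.
Unshelve. all: end_near. Qed.

(** * The differential operator and the Petrov-Galerkin matrix *)

Section petrov_galerkin.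
Set Implicit Arguments.
Unset Strict Implicit.
Context {R : realType}.
Local Notation D := (`[(-1 : R), 1]%classic).
Variables (N : nat) (a : nat -> R -> R).
Hypothesis ca : forall k, (k <= N)%N -> {within D, continuous (a k)}.

Let cak (k : 'I_N.+1) j :
  {within D, continuous (fun x => a k x * ((chebyshev_poly R j)^`(k)).[x])}.
Proof.
by apply: continuous_within_mul_horner; apply: ca; rewrite -ltnS.
Qed.

(** The factors 1 give the sum the shape of [uinner_suml]. *)
Lemma diff_operatorE p x : diff_operator N a (horner p) x =
  \sum_(k < N.+1) 1 * (a k x * (p^`(k)).[x]).
Proof. by apply: eq_bigr => k _; rewrite derive1n_horner mul1r. Qed.

Let diff_operator_chebyshevE j : diff_operator N a (horner (chebyshev_poly R j)) =
  fun x => \sum_(k < N.+1) 1 * (a k x * ((chebyshev_poly R j)^`(k)).[x]).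
Proof. by apply/funext => x; rewrite diff_operatorE. Qed.

Let sumP j p := @uinner_suml R N _ (fun=> 1)
  (fun (k : 'I_N.+1) x => a k x * ((chebyshev_poly R j)^`(k)).[x]) p
  (fun k => @cak k j).

Lemma continuous_diff_operator_chebyshev j :
  {within D, continuous (diff_operator N a (horner (chebyshev_poly R j)))}.
Proof.
by rewrite diff_operator_chebyshevE; have [] := sumP j 0.
Qed.

(** Each summand is the i-th C^(N)-coefficient of a^k times the k-th derivative of T_j: directly for
    k = N, after the conversions for k < N. Linearity of the inner product adds them up. *)
Lemma us_operatorE i j :
  us_operator N a i j = ucoef N (diff_operator N a (horner (chebyshev_poly R j))) i.
Proof.
rewrite /us_operator multop_diffop; last exact: ca.
rewrite diff_operator_chebyshevE /ucoef; have [_ ->] := sumP j (ubasis R N i).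
rewrite mulr_suml big_ord_recr/= addrC mul1r; congr (_ + _).
apply: eq_bigr => k _; rewrite mul1r.
rewrite (@convop_prod_ucoef _ N k (fun x => a k x * ((chebyshev_poly R j)^`(k)).[x])) //.
- exact: ltnW.
- exact: (@cak (widen_ord (leqnSn N) k) j).
- by move=> l; rewrite multop_diffop//; apply: ca; rewrite ltnW.
Qed.

Lemma uinner_gegenbauer_diff_operator l j : (0 < N)%N ->
  uinner N (diff_operator N a (horner (chebyshev_poly R j)))
    (horner (gegenbauer_poly R N l)) =
  dnorm R N l * us_operator N a l j.
Proof.
move=> N0; have E : gegenbauer_poly R N l = ubasis R N l by rewrite /ubasis gtn_eqF.
rewrite us_operatorE dnormE// /ucoef uinner_ubasis_norm E.
by rewrite mulrC divfK// ubasis_norm_neq0.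
Qed.

End petrov_galerkin.

Theorem theorem2p1 (R : realType) (N n : nat)
  (hN : (1 <= N)%N) (hn : (1 <= n)%N)
  (a : nat -> R -> R)
  (a_smooth : forall k : nat, (k <= N)%N -> smooth_on `[(-1 : R), 1] (a k))
  (aN_neq0 : forall x : R, x \in `[(-1 : R), 1] -> a N x != 0)
  (B : 'I_N -> {scalar {poly R}})
  (m : nat) (B' : 'I_m -> {scalar {poly R}})
  (Rs Qs : 'M[R]_(n + N, n))
  (phi psi : 'I_n -> {poly R})
  (Rs_banded : stencil_banded Rs)
  (Rs_neq0 : forall (i : 'I_(n + N)) (k : 'I_n),
     nat_of_ord i = (k + N)%N -> Rs i k != 0)
  (phiE : forall k : 'I_n, phi k = quasimul (chebyshev_poly R) Rs k)
  (phi_B : forall (i : 'I_N) (k : 'I_n), B i (phi k) = 0)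
  (Qs_banded : stencil_banded Qs)
  (psiE : forall k : 'I_n, psi k = quasimul (gegenbauer_poly R N) Qs k)
  (psi_B' : forall (i : 'I_m) (k : 'I_n), B' i (psi k) = 0)
  (A : 'M[R]_n)
  (AE : forall i j : 'I_n,
     A i j = uinner N (horner (psi i)) (diff_operator N a (horner (phi j)))) :
  A = Qs^T *m diag_mx (\row_(j < n + N) dnorm R N j)
      *m infmx_section (n + N) (us_operator N a) *m Rs.
Proof.
have ca k : (k <= N)%N -> {within `[(-1 : R), 1], continuous (a k)}.
  by move=> /a_smooth; exact: smooth_on_continuous.
have cL m' := continuous_diff_operator_chebyshev ca m'.
(* The product is flipped because the linearity lemmas take a continuous function on the left and a
   polynomial on the right. *)
apply/matrixP => i j; rewrite AE uinnerC.
(* Linearity of the differential operator reduces its value at phi_j to its values at the Chebyshev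
   polynomials. *)
rewrite (_ : diff_operator N a (horner (phi j)) = fun x => \sum_(l < n + N)
    Rs l j * diff_operator N a (horner (chebyshev_poly R l)) x); last first.
  apply/funext => x; rewrite phiE /quasimul diff_operatorE.
  under [RHS]eq_bigr do rewrite diff_operatorE mulr_sumr.
  rewrite exchange_big/=; apply: eq_bigr => k _.
  rewrite mul1r linear_sum /= horner_sum mulr_sumr; apply: eq_bigr => l _.
  by rewrite derivnZ hornerZ; ring.
have [cS _] := uinner_suml N (fun l : 'I_(n + N) => Rs l j) (psi i) (fun l => cL l).
rewrite psiE /quasimul uinner_sumr//.
rewrite mxE; under [RHS]eq_bigr do rewrite mxE mulr_suml.
(* After the exchange the outer index [l] runs over the test basis C^(N)_l and the inner one over
   the trial basis, in the order of the expanded inner product. *)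
rewrite exchange_big/=; apply: eq_bigr => l _.
have [_ ->] := uinner_suml N (fun l : 'I_(n + N) => Rs l j) (gegenbauer_poly R N l)
  (fun l => cL l).
rewrite mulr_sumr; apply: eq_bigr => r _.
rewrite mul_mx_diag !mxE uinner_gegenbauer_diff_operator//.
by ring.
Qed.
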